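(* Consider the branch-and-bound enumeration for a convex mixed-integer quadratic program described in the context, with data $Q\succ 0$, $c$, $d$, $A\in\mathbb{R}^{m\times n}$, $b$ and predetermined branching order. After a polynomial time preprocessing, at every node given by a fixing $r=(r_1,\dots,r_\ell)$ at depth $\ell$ the dual of the continuous relaxation, $-\min\{\lambda^\top\widetilde Q_\ell\lambda+\widetilde c(r)^\top\lambda+\tilde d(r):\lambda\in\mathbb{R}^m,\ \lambda\ge0\}$, can be constructed (incrementally) in $O(n-\ell+m)$ time per node.
   Context: Problem (MIQP): minimize $f(x)=x^\top Qx+c^\top x+d$ subject to $Ax\le b$, $x_i\in\mathbb{Z}$ for $i=1,\dots,n_1$, $x_i\in\mathbb{R}$ for $i=n_1+1,\dots,n$, where $Q=(q_{ij})\in\mathbb{R}^{n\times n}$ is symmetric positive definite, $c\in\mathbb{R}^n$, $d\in\mathbb{R}$, $A\in\mathbb{R}^{m\times n}$, $b\in\mathbb{R}^m$. Branch-and-bound tree: the integer variables are fixed one at a time in the predetermined order $x_1,x_2,\dots$; a node at depth $\ell\in\{0,\dots,n_1-1\}$ is a fixing $r=(r_1,\dots,r_\ell)\in\mathbb{Z}^\ell$ of the first $\ell$ variables, and for $\ell\ge1$ its parent is $r'=(r_1,\dots,r_{\ell-1})$. The reduced problem at node $r$ is to minimize $x^\top Q_\ell x+c(r)^\top x+d(r)$ subject to $A_\ell x\le b(r)$ over the remaining $n-\ell$ variables, where $Q_\ell$ arises from $Q$ by deleting the first $\ell$ rows and columns, $A_\ell$ from $A$ by deleting the first $\ell$ columns,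 $c(r)_{j-\ell}=c_j+2\sum_{i=1}^\ell q_{ij}r_i$ for $j=\ell+1,\dots,n$, $d(r)=d+\sum_{i=1}^\ell c_ir_i+\sum_{i,j=1}^\ell q_{ij}r_ir_j$, and $b(r)=b-\sum_{i=1}^\ell r_iA_{\cdot,i}$. The data of the dual problem at node $r$ are $\widetilde Q_\ell=\frac14A_\ell Q_\ell^{-1}A_\ell^\top$ (depending only on the depth $\ell$), $\widetilde c(r)=\frac12A_\ell Q_\ell^{-1}c(r)+b(r)$ and $\tilde d(r)=\frac14c(r)^\top Q_\ell^{-1}c(r)-d(r)$; constructing the problem means making these data available, where quantities computed in the preprocessing (such as $\widetilde Q_\ell$ for each $\ell$) may be referred to without copying. Running time counts arithmetic operations. ''Preprocessing'' is a computation from the input data $(Q,c,d,A,b,n_1)$ only, done once before the enumeration (including the root node). ''Incrementally in time $T$ per node'' means: auxiliary data can be maintained with each node so that, given the data stored at the parent $r'$, the value $r_\ell$ and the preprocessed data, the desired quantities and the data to be stored at $r$ are computed in time $T$. *)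

(* Defs.v *)
From mathcomp Require Import all_boot all_order all_algebra.
From mathcomp Require Export reals.

Set Implicit Arguments.
Unset Strict Implicit.
Unset Printing Implicit Defensive.

Import Order.TTheory GRing.Theory Num.Theory.
Local Open Scope ring_scope.

(* The problem  min x^T objQ x + objc^T x + objd  s.t.  conA x <= conb,
   where the first n_int variables are integer and the others real. *)
Record miqp (R : Type) (n m : nat) := MIQP {
  objQ : 'M[R]_n;
  objc : 'cV[R]_n;
  objd : R;
  conA : 'M[R]_(m, n);
  conb : 'cV[R]_m;
  n_int : nat
}.

Definition posdef (R : realFieldType) n (Q : 'M[R]_n) : Prop :=
  Q^T = Q /\ forall x : 'cV[R]_n, x != 0 -> 0 < (x^T *m Q *m x) 0 0.

Lemma free_var_subproof n l (j : 'I_(n - l)) : (l + j < n)%N.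
Proof. by rewrite -ltn_subRL. Qed.

(* Index, among all n variables, of the j-th variable that remains once the
   first l variables are fixed. *)
Definition free_var n l (j : 'I_(n - l)) : 'I_n := Ordinal (free_var_subproof j).

(* A node is the sequence r of the values fixed for the first [size r]
   variables; rcons r v is the child of r obtained by fixing the next one. *)
Definition reduced (R : realFieldType) n m (P : miqp R n m) (r : seq int) :
    miqp R (n - size r) m :=
  let v (i : nat) : R := (r`_i)%:~R in
  let l := size r in
  {| objQ := \matrix_(i, j) objQ P (free_var i) (free_var j);
     objc := \col_j (objc P (free_var j) 0 +
               2 * \sum_(i < n | (i < l)%N) objQ P i (free_var j) * v i);
     objd := objd P + \sum_(i < n | (i < l)%N) objc P i 0 * v i +
               \sum_(i < n | (i < l)%N) \sum_(j < n | (j < l)%N)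
                 objQ P i j * v i * v j;
     conA := \matrix_(k, j) conA P k (free_var j);
     conb := \col_k (conb P k 0 - \sum_(i < n | (i < l)%N) v i * conA P k i);
     n_int := n_int P - l |}.

(* The problem  - min { y^T dualQ y + dualc^T y + duald : y >= 0 }. *)
Record dual_qp (R : Type) (m : nat) := DualQP {
  dualQ : 'M[R]_m;
  dualc : 'cV[R]_m;
  duald : R
}.

(* Dual of the continuous relaxation, i.e. of the problem without the
   integrality constraints. *)
Definition relaxation_dual (R : realFieldType) n m (P : miqp R n m) :
    dual_qp R m :=
  let Qi := invmx (objQ P) in
  {| dualQ := 4^-1 *: (conA P *m Qi *m (conA P)^T);
     dualc := 2^-1 *: (conA P *m Qi *m objc P) + conb P;
     duald := 4^-1 * ((objc P)^T *m Qi *m objc P) 0 0 - objd P |}.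

(* Model of computation: a random-access machine over the ordered field R with
   unit cost, programmed with bounded loops.  A program is a fixed finite
   object, independent of the dimensions and of the data.  The memory is split
   into regions; each region consists of arrays with names in nat, whose cells
   are addressed by lists of natural numbers and hold elements of R.  Natural
   numbers only serve as loop bounds and array indices. *)
Inductive region := Input | Pre | Parent | Node.

Definition region_eqb (g h : region) : bool :=
  match g, h with
  | Input, Input | Pre, Pre | Parent, Parent | Node, Node => true
  | _, _ => false
  end.

Inductive nexp :=
  | NConst of nat
  | NVar of nat
  | NAdd of nexp & nexp
  | NSub of nexp & nexp.

Inductive rexp :=
  | RConst of int
  | RGet of region & nat & seq nexp
  | RAdd of rexp & rexp
  | RSub of rexp & rexp
  | RMul of rexp & rexp
  | RDiv of rexp & rexp.

Inductive cmd :=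
  | Skip
  | Seq of cmd & cmd
  | Set_ of region & nat & seq nexp & rexp
  | IfN of nexp & nexp & cmd & cmd
  | IfR of rexp & rexp & cmd & cmd
  | For of nat & nexp & cmd.

(* The regions that a program may modify. *)
Fixpoint writes_only (ok : pred region) (p : cmd) : bool :=
  match p with
  | Skip => true
  | Seq p1 p2 => writes_only ok p1 && writes_only ok p2
  | Set_ g _ _ _ => ok g
  | IfN _ _ p1 p2 => writes_only ok p1 && writes_only ok p2
  | IfR _ _ p1 p2 => writes_only ok p1 && writes_only ok p2
  | For _ _ p1 => writes_only ok p1
  end.

Definition may_write_pre : pred region :=
  fun g => region_eqb g Pre || region_eqb g Node.
Definition may_write_node : pred region := fun g => region_eqb g Node.

Definition env := nat -> nat.
Definition regmem (R : Type) := nat -> seq nat -> R.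
Definition mem (R : Type) := region -> regmem R.

Definition set_env (e : env) (x k : nat) : env :=
  fun y => if y == x then k else e y.

Definition set_mem (R : Type) (s : mem R) g a (idx : seq nat) (v : R) : mem R :=
  fun g' a' idx' =>
    if [&& region_eqb g' g, a' == a & idx' == idx] then v else s g' a' idx'.

Fixpoint neval (e : env) (t : nexp) : nat :=
  match t with
  | NConst k => k
  | NVar x => e x
  | NAdd t1 t2 => neval e t1 + neval e t2
  | NSub t1 t2 => neval e t1 - neval e t2
  end%N.

Fixpoint ncost (t : nexp) : nat :=
  match t with
  | NConst _ | NVar _ => 1
  | NAdd t1 t2 | NSub t1 t2 => 1 + ncost t1 + ncost t2
  end%N.

Definition idxcost (ts : seq nexp) : nat := sumn (map ncost ts).

Fixpoint reval (R : realFieldType) (e : env) (s : mem R) (t : rexp) : R :=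
  match t with
  | RConst z => z%:~R
  | RGet g a ts => s g a (map (neval e) ts)
  | RAdd t1 t2 => reval e s t1 + reval e s t2
  | RSub t1 t2 => reval e s t1 - reval e s t2
  | RMul t1 t2 => reval e s t1 * reval e s t2
  | RDiv t1 t2 => reval e s t1 / reval e s t2
  end.

Fixpoint rcost (t : rexp) : nat :=
  match t with
  | RConst _ => 1
  | RGet _ _ ts => 1 + idxcost ts
  | RAdd t1 t2 | RSub t1 t2 | RMul t1 t2 | RDiv t1 t2 =>
      1 + rcost t1 + rcost t2
  end%N.

(* The second component accumulates the number of elementary steps: besides
   the arithmetic operations in R, every memory access, assignment, test,
   loop iteration and index operation is charged. *)
Fixpoint exec (R : realFieldType) (p : cmd) (e : env) (st : mem R * nat) :
    mem R * nat :=
  let: (s, t) := st in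
  match p with
  | Skip => (s, t)
  | Seq p1 p2 => exec p2 e (exec p1 e (s, t))
  | Set_ g a ts u =>
      (set_mem s g a (map (neval e) ts) (reval e s u),
       t + (1 + idxcost ts + rcost u))%N
  | IfN u v p1 p2 =>
      let t' := (t + (1 + ncost u + ncost v))%N in
      if (neval e u <= neval e v)%N then exec p1 e (s, t') else exec p2 e (s, t')
  | IfR u v p1 p2 =>
      let t' := (t + (1 + rcost u + rcost v))%N in
      if reval e s u <= reval e s v then exec p1 e (s, t') else exec p2 e (s, t')
  | For x u p1 =>
      foldl (fun st' k => exec p1 (set_env e x k) (st'.1, st'.2.+1))
            (s, t + (1 + ncost u))%N (iota 0 (neval e u))
  end.

(* Names of the arrays holding the input, of the input scalar holding the
   value fixed last, and of the arrays holding the output. *)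
Definition aQ : nat := 0.
Definition ac : nat := 1.
Definition ad : nat := 2.
Definition aA : nat := 3.
Definition ab : nat := 4.
Definition aval : nat := 5.
Definition out_dualQ : nat := 6.
Definition out_dualc : nat := 7.
Definition out_duald : nat := 8.

Definition cell1 (R : zmodType) n (f : 'I_n -> R) (i : nat) : R :=
  if insub i is Some i' then f i' else 0.

(* Vector and matrix entries are stored with 0-based indices. *)
Definition input_region (R : realFieldType) n m (P : miqp R n m) (v : int) :
    regmem R :=
  fun a idx =>
    match idx with
    | [:: i; j] =>
        if a == aQ then cell1 (fun i' => cell1 (objQ P i') j) i
        else if a == aA then cell1 (fun i' => cell1 (conA P i') j) i
        else 0
    | [:: i] =>
        if a == ac then cell1 (fun i' => objc P i' 0) i
        else if a == ab then cell1 (fun i' => conb P i' 0) i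
        else 0
    | [::] =>
        if a == ad then objd P else if a == aval then v%:~R else 0
    | _ => 0
    end.

Definition empty_region (R : zmodType) : regmem R := fun _ _ => 0.

(* Index variables 0, 1, 2, 3 initially hold n, m, the number of integer
   variables and the depth of the node. *)
Definition init_env (R : Type) n m (P : miqp R n m) (l : nat) : env :=
  fun x => nth 0%N [:: n; m; n_int P; l] x.

Definition init_mem (R : realFieldType) n m (P : miqp R n m) (v : int)
    (pre parent : regmem R) : mem R :=
  fun g => match g with
           | Input => input_region P v
           | Pre => pre
           | Parent => parent
           | Node => @empty_region R
           end.

Definition run_pre (R : realFieldType) n m (pre_prog : cmd) (P : miqp R n m) :
    mem R * nat :=
  exec pre_prog (init_env P 0)
       (init_mem P 0 (@empty_region R) (@empty_region R), 0%N).

Definition pre_data (R : realFieldType) n m pre_prog (P : miqp R n m) :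
    regmem R :=
  (run_pre pre_prog P).1 Pre.

Definition pre_time (R : realFieldType) n m pre_prog (P : miqp R n m) : nat :=
  (run_pre pre_prog P).2.

(* Run at a node of depth l >= 1 whose last fixed value is v, from the data
   [parent] stored at its parent. *)
Definition run_node (R : realFieldType) n m (pre_prog node_prog : cmd)
    (P : miqp R n m) (l : nat) (v : int) (parent : regmem R) : mem R * nat :=
  exec node_prog (init_env P l)
       (init_mem P v (pre_data pre_prog P) parent, 0%N).

(* The data stored at the node whose fixing is the reversal of s; those of the
   root are left by the preprocessing in the region Node. *)
Fixpoint stored_rev (R : realFieldType) n m (pre_prog node_prog : cmd)
    (P : miqp R n m) (s : seq int) : regmem R :=
  match s with
  | [::] => (run_pre pre_prog P).1 Node
  | v :: s' =>
      (run_node pre_prog node_prog P (size s) v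
         (stored_rev pre_prog node_prog P s')).1 Node
  end.

Definition stored (R : realFieldType) n m pre_prog node_prog (P : miqp R n m)
    (r : seq int) : regmem R :=
  stored_rev pre_prog node_prog P (rev r).

(* Time spent at the node rcons r v. *)
Definition node_time (R : realFieldType) n m pre_prog node_prog
    (P : miqp R n m) (r : seq int) (v : int) : nat :=
  (run_node pre_prog node_prog P (size r).+1 v
     (stored pre_prog node_prog P r)).2.

(* The data of the dual D at a node of depth l are available: the quadratic
   part by reference, as slice l of a preprocessed array, and the other parts
   in the memory of the node itself. *)
Definition available (R : realFieldType) m (D : dual_qp R m) (l : nat)
    (pre node : regmem R) : Prop :=
  [/\ forall i j : 'I_m, pre out_dualQ [:: l; i : nat; j : nat] = dualQ D i j,
      forall i : 'I_m, node out_dualc [:: i : nat] = dualc D i 0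
    & node out_duald [::] = duald D].

(* Main.v *)
Require Import Defs.
From mathcomp Require Import all_boot all_order all_algebra.
From mathcomp Require Import reals.
From mathcomp Require Import ring zify.

(** The preprocessing runs the Gram-Schmidt process on the unit vectors, from
    the last to the first, for the inner product given by Q.  It yields vectors
    u_0, ..., u_(n-1) with u_k supported on the coordinates >= k, with k-th
    coordinate 1, and with (Q u_k)_i = 0 for i > k; positive definiteness makes
    s_k := (Q u_k)_k = u_k^T Q u_k positive.  Because of the supports, the
    vectors u_k with k >= l are mutually conjugate for the trailing block Q_l
    as well, so one family serves all depths:

      Q_l^-1 = sum over k >= l of u_k u_k^T / s_k       ([trailing_inv]).

    Let p_k := A u_k, let G i k := (Q u_k)_i, and let gamma_k(r) := u_k^T c(r)
    for k >= l, where l is the length of r.  The dual data at r become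
    ([relaxation_dualE])

      quadratic part  1/4 sum over k >= l of p_k p_k^T / s_k,
      linear part     1/2 sum over k >= l of p_k gamma_k(r) / s_k + b(r),
      constant        1/4 sum over k >= l of gamma_k(r)^2 / s_k - d(r).

    The quadratic part depends on l only and is preprocessed.  Fixing the
    variable of index l to v adds 2 v times row l of Q to the linear objective,
    hence adds 2 v (G l k) to gamma_k: all the gamma_k together are updated
    in O(n - l) operations, after which the constant is one sum over k.  In
    the linear part the term k = l disappears and the others change by v times
    the vector sum over k > l of p_k (G l k) / s_k, which does not depend on r
    and is preprocessed; this update takes O(m) operations
    ([dual_lin_rcons]).  A node therefore stores the gamma_k, the trailing part
    of c(r), d(r) and the dual data.

    On the side of the machine, both programs are sequences of loop nests that
    add terms to the cells of one array, and the effect of such a nest is a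
    finite sum ([run_add_nest]).  The only genuine recursion is the
    Gram-Schmidt loop, which is treated by an invariant ([gram_schmidt_run]).
    The running time is at most a constant depending on the program, times a
    bound on the loop ranges to the power of the nesting depth ([exec_time]);
    the node program has no nested loops. *)

Set Implicit Arguments.
Unset Strict Implicit.
Unset Printing Implicit Defensive.

Import Order.TTheory GRing.Theory Num.Theory.
Local Open Scope ring_scope.

(** * Conjugate directions and inverses of trailing blocks *)

Section Sums.
Variable R : realFieldType.

Lemma sum_shift (n l : nat) (F : nat -> R) :
  \sum_(t < n - l) F (l + t)%N = \sum_(l <= k < n) F k.
Proof.
rewrite -[l in RHS]add0n big_addn big_mkord.
by apply: eq_bigr => t _; rewrite addnC.
Qed.

Lemma sum_pick (N k0 : nat) (F : nat -> R) :
  (k0 < N)%N -> (forall k, (k < N)%N -> k != k0 -> F k = 0) ->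
  \sum_(k < N) F k = F k0.
Proof.
move=> lt0 F0; rewrite (bigD1 (Ordinal lt0)) //= big1 ?addr0 // => k ne.
by apply: F0.
Qed.

End Sums.

Section Conjugate.
Variable R : realFieldType.
Implicit Types (q u : nat -> nat -> R) (x y : nat -> R).

Definition dot n x y := \sum_(j < n) x j * y j.

Lemma dotC n x y : dot n x y = dot n y x.
Proof. by apply: eq_bigr => j _; rewrite mulrC. Qed.

Lemma eq_dot n x y y' :
  (forall j, (j < n)%N -> y j = y' j) -> dot n x y = dot n x y'.
Proof. by move=> e; apply: eq_bigr => j _; rewrite e. Qed.

Lemma dot_tail n l x y :
  (forall j, (j < l)%N -> y j = 0) ->
  dot n x y = \sum_(j < n - l) x (l + j)%N * y (l + j)%N.
Proof.
move=> y0; pose F j := x j * y j.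
rewrite (sum_shift n l F) /dot -(big_mkord xpredT F).
case: (leqP l n) => [le|lt].
  rewrite (big_cat_nat (leq0n l) le) /= big_nat big1 ?add0r //.
  by move=> i /andP[_ /y0 yi]; rewrite /F yi mulr0.
rewrite [RHS]big_geq 1?ltnW // big_nat big1 // => i /andP[_ ltn].
by rewrite /F y0 ?mulr0 // (ltn_trans ltn).
Qed.

(** The indices are natural numbers and rows of u are the directions, as in the
    arrays of the programs; u k is orthogonal to the unit vectors of index > k
    for the form q, which by triangularity is conjugacy to the later u i. *)
Definition conjugate n l q u := forall k, (l <= k < n)%N ->
  [/\ u k k = 1, forall j, (j < k)%N -> u k j = 0,
      forall i, (k < i < n)%N -> dot n (q i) (u k) = 0
    & 0 < dot n (q k) (u k)].

Lemma eq_conjugate n l q u u' :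
  (forall k j, (l <= k < n)%N -> u' k j = u k j) ->
  conjugate n l q u -> conjugate n l q u'.
Proof.
move=> e cu k lk; have [u1 u0 q0 qp] := cu k lk.
have ek x : dot n x (u' k) = dot n x (u k) by apply: eq_dot => j _; apply: e.
by split=> [|j jk|i ki|]; rewrite ?e ?ek //; [exact: u0|exact: q0].
Qed.

(** If b < a, then the support of u a misses the support of Q (u b); symmetry of
    q reduces a < b to this case. *)
Lemma conjugate_dot n l q u a b :
  (forall i j, q i j = q j i) -> conjugate n l q u ->
  (l <= a < n)%N -> (l <= b < n)%N ->
  dot n (u a) (fun i => dot n (q i) (u b)) =
    if a == b then dot n (q a) (u a) else 0.
Proof.
move=> qC cu.
have swap (x y : nat -> R) : dot n x (fun i => dot n (q i) y) =
    dot n y (fun i => dot n (q i) x).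
  rewrite /dot; under eq_bigr do rewrite mulr_sumr.
  rewrite exchange_big /=; apply: eq_bigr => i _; rewrite mulr_sumr.
  by apply: eq_bigr => j _; rewrite (qC j); ring.
have low a' b' : (l <= a' < n)%N -> (l <= b' < n)%N -> (b' < a')%N ->
    dot n (u a') (fun i => dot n (q i) (u b')) = 0.
  move=> ra rb ltba; rewrite /dot big1 // => i _.
  have [_ ua0 _ _] := cu _ ra; have [_ _ qb0 _] := cu _ rb.
  case: (ltnP i a') => [/ua0->|lei]; first by rewrite mul0r.
  by rewrite -/(dot n _ _) qb0 ?mulr0 // ltn_ord (leq_trans ltba).
move=> ra rb; case: (ltngtP a b) => [lt|lt|<-]; [|exact: low|].
  by rewrite swap low.
have [ua1 ua0 qa0 _] := cu _ ra.
rewrite /dot (@sum_pick _ n a (fun i => u a i * dot n (q i) (u a))).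
- by rewrite ua1 mul1r.
- by case/andP: ra.
move=> i ltin ne; case: (ltnP i a) => [/ua0->|lei]; first by rewrite mul0r.
by rewrite qa0 ?mulr0 // ltin andbT ltn_neqAle eq_sym ne.
Qed.

Definition trailing n l q : 'M[R]_(n - l) :=
  \matrix_(i, j) q (l + i)%N (l + j)%N.

(** With U the matrix of the trailing directions, U Q_l U^T is an invertible
    diagonal matrix D by conjugacy, so Q_l^-1 = U^T D^-1 U.  The conclusion is
    stated for products X Q_l^-1 Y, the form in which the inverse occurs in the
    dual problem. *)
Lemma trailing_inv n l q u :
  (forall i j, q i j = q j i) -> conjugate n l q u ->
  trailing n l q \in unitmx /\
  forall a b (X : 'M_(a, n - l)) (Y : 'M_(n - l, b)) i j x y,
    (forall t : 'I_(n - l), X i t = x (l + t)%N) ->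
    (forall t : 'I_(n - l), Y t j = y (l + t)%N) ->
    (X *m invmx (trailing n l q) *m Y) i j =
    \sum_(l <= k < n) dot n x (u k) * dot n y (u k) / dot n (q k) (u k).
Proof.
move=> qC cu.
have rng (k : 'I_(n - l)) : (l <= l + k < n)%N.
  by rewrite leq_addr -ltn_subRL ltn_ord.
pose U : 'M[R]_(n - l) := \matrix_(k, i) u (l + k)%N (l + i)%N.
pose D : 'rV[R]_(n - l) := \row_k dot n (q (l + k)%N) (u (l + k)%N).
pose E : 'rV[R]_(n - l) := \row_k (D 0 k)^-1.
have tail (k : 'I_(n - l)) x :
    dot n x (u (l + k)%N) =
      \sum_(j < n - l) x (l + j)%N * u (l + k)%N (l + j)%N.
  apply: dot_tail => j jl; have [_ u0 _ _] := cu _ (rng k).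
  by apply: u0; rewrite (leq_trans jl) ?leq_addr.
have UQU : U *m (trailing n l q *m U^T) = diag_mx D.
  apply/matrixP => k k'; rewrite !mxE.
  transitivity (dot n (u (l + k)%N) (fun i => dot n (q i) (u (l + k')%N))).
    rewrite dotC tail; apply: eq_bigr => i _; rewrite !mxE mulrC tail.
    by congr (_ * _); apply: eq_bigr => j _; rewrite !mxE.
  rewrite (conjugate_dot qC cu) // eqn_add2l -val_eqE /=.
  by case: eqP => // /eqP /val_inj ->.
have DE : diag_mx D *m diag_mx E = 1%:M.
  rewrite mulmx_diag; apply/matrixP => k k'; rewrite !mxE.
  case: eqP => [_|] //; rewrite mulr1n mulfV //.
  by have [_ _ _ /lt0r_neq0] := cu _ (rng k).
have QH : trailing n l q *m (U^T *m diag_mx E *m U) = 1%:M.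
  rewrite !mulmxA; apply: mulmx1C.
  by rewrite -DE -UQU !mulmxA.
have [uQ _] := mulmx1_unit QH; split=> // a b X Y i j x y Xx Yy.
have -> : invmx (trailing n l q) = U^T *m diag_mx E *m U.
  by rewrite -[RHS](mulKmx uQ) QH mulmx1.
have -> : X *m (U^T *m diag_mx E *m U) *m Y =
    (X *m U^T) *m diag_mx E *m (U *m Y) by rewrite !mulmxA.
rewrite mul_mx_diag mxE.
rewrite -(sum_shift n l
  (fun k => dot n x (u k) * dot n y (u k) / dot n (q k) (u k))).
apply: eq_bigr => k _; rewrite !mxE !tail mulrAC; congr (_ * _ / _).
- by apply: eq_bigr => t _; rewrite !mxE Xx.
- by apply: eq_bigr => t _; rewrite !mxE Yy mulrC.
Qed.

(** The hypothesis on u l is the Gram-Schmidt formula.  Orthogonality to the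
    unit vector of index i > l amounts to
    q i l = sum over k > l of (Q u_k)_i (Q u_k)_l / s_k,
    which is the entry of Q_(l+1) Q_(l+1)^-1 (Q e_l) given by the inverse built
    from the previous directions. *)
Lemma gram_schmidt_step n l q u :
  (forall i j, q i j = q j i) ->
  (forall x, (exists2 i, (i < n)%N & x i != 0) ->
     0 < dot n x (fun i => dot n (q i) x)) ->
  (l < n)%N -> conjugate n l.+1 q u ->
  (forall j, (j < n)%N -> u l j = (j == l)%:R -
     \sum_(l.+1 <= k < n) u k j * dot n (q l) (u k) / dot n (q k) (u k)) ->
  conjugate n l q u.
Proof.
move=> qC qpos ltln cu ul.
have low j : (j <= l)%N -> u l j = (j == l)%:R.
  move=> le; rewrite ul ?(leq_ltn_trans le) // big_nat big1 ?subr0 // => k rk.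
  have [_ u0 _ _] := cu _ rk; case/andP: rk => lk _.
  by rewrite u0 ?mul0r // (leq_ltn_trans le).
have orth i : (l < i < n)%N -> dot n (q i) (u l) = 0.
  move=> ri.
  have -> : dot n (q i) (u l) = q i l -
      \sum_(l.+1 <= k < n)
        dot n (q i) (u k) * dot n (q l) (u k) / dot n (q k) (u k).
    rewrite [LHS](eq_bigr (fun j : 'I_n => q i j * (val j == l)%:R -
      \sum_(l.+1 <= k < n)
        q i j * u k j * dot n (q l) (u k) / dot n (q k) (u k))).
      rewrite sumrB exchange_big /=; congr (_ - _).
        rewrite (@sum_pick _ n l (fun j => q i j * (j == l)%:R)) ?eqxx
          ?mulr1 //.
        by move=> k _ /negbTE->; rewrite mulr0.
      by apply: eq_bigr => k _; rewrite /dot !mulr_suml.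
    move=> j _; rewrite ul // mulrBr mulr_sumr; congr (_ - _).
    by apply: eq_bigr => k _; rewrite !mulrA.
  have [uQ bil] := trailing_inv qC cu.
  have il : (i - l.+1 < n - l.+1)%N by lia.
  have ie : (l.+1 + (i - l.+1))%N = i by lia.
  rewrite -(bil _ 1 (trailing n l.+1 q) (\col_t q (l.+1 + t)%N l) (Ordinal il) 0
    (q i) (q l)).
  - by rewrite mulmxV // mul1mx mxE /= ie subrr.
  - by move=> t; rewrite mxE /= ie.
  - by move=> t; rewrite mxE.
move=> k /andP[]; rewrite leq_eqVlt => /orP[/eqP<- _|lk kn]; last first.
  by apply: cu; rewrite lk.
have ul1 : u l l = 1 by rewrite low ?eqxx.
split=> //.
  by move=> j jl; rewrite low 1?ltnW // ltn_eqF.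
suff <- : dot n (u l) (fun i => dot n (q i) (u l)) = dot n (q l) (u l).
  by apply: qpos; exists l; rewrite // ul1 oner_neq0.
rewrite [LHS](@sum_pick _ n l (fun i => u l i * dot n (q i) (u l))) ?ul1
  ?mul1r //.
move=> i ltin ne; case: (ltnP i l) => [il|li].
  by rewrite low 1?ltnW // (negbTE ne) mul0r.
by rewrite orth ?mulr0 // ltin andbT ltn_neqAle eq_sym ne.
Qed.

End Conjugate.

(** * Time and effect of programs *)

(** Cost of a program when every loop body is executed once. *)
Fixpoint steps (p : cmd) : nat :=
  match p with
  | Skip => 0
  | Seq p1 p2 => steps p1 + steps p2
  | Set_ _ _ ts u => 1 + idxcost ts + rcost u
  | IfN u v p1 p2 => 1 + ncost u + ncost v + (steps p1 + steps p2)
  | IfR u v p1 p2 => 1 + rcost u + rcost v + (steps p1 + steps p2)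
  | For _ u p1 => 2 + ncost u + steps p1
  end%N.

Fixpoint nesting (p : cmd) : nat :=
  match p with
  | Skip | Set_ _ _ _ _ => 0
  | Seq p1 p2 | IfN _ _ p1 p2 | IfR _ _ p1 p2 => maxn (nesting p1) (nesting p2)
  | For _ _ p1 => (nesting p1).+1
  end.

(** The environment is tracked because the range of an inner loop may depend on
    the outer loop variables. *)
Fixpoint loops_below (N : nat) (p : cmd) (e : env) : Prop :=
  match p with
  | Skip | Set_ _ _ _ _ => True
  | Seq p1 p2 | IfN _ _ p1 p2 | IfR _ _ p1 p2 =>
      loops_below N p1 e /\ loops_below N p2 e
  | For x u p1 => (neval e u <= N)%N /\
      forall k, (k < neval e u)%N -> loops_below N p1 (set_env e x k)
  end.

Section Programs.
Variable R : realFieldType.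
Implicit Types (p : cmd) (e : env) (s : Defs.mem R) (t : nat).

(** Each level of nesting multiplies the number of executions of a command by
    at most N; loop overheads are absorbed since N is positive. *)
Lemma exec_time N p e s t : (0 < N)%N -> loops_below N p e ->
  ((exec p e (s, t)).2 <= t + steps p * N ^ nesting p)%N.
Proof.
move=> N0.
have up a i j : (i <= j -> a * N ^ i <= a * N ^ j)%N.
  by move=> le; rewrite leq_mul2l leq_pexp2l ?orbT.
have two p1 p2 i j c : (steps p1 * N ^ i + steps p2 * N ^ j + c <=
    (c + (steps p1 + steps p2)) * N ^ maxn i j)%N.
  rewrite addnC !mulnDl leq_add ?leq_add ?up ?leq_maxl ?leq_maxr //.
  by rewrite leq_pmulr // expn_gt0 N0.
elim: p e s t => [|p1 IH1 p2 IH2|g a ts u|u v p1 IH1 p2 IH2|u v p1 IH1 p2 IH2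
    |x u p1 IH1] e s t /=.
- by rewrite addn0.
- case=> b1 b2; case E: (exec p1 e (s, t)) => [s' t'].
  have := IH1 e s t b1; rewrite E /= => le.
  apply: leq_trans (IH2 _ _ _ b2) _.
  by have := two p1 p2 (nesting p1) (nesting p2) 0%N; lia.
- by rewrite muln1.
- case=> b1 b2.
  have h := two p1 p2 (nesting p1) (nesting p2) (1 + ncost u + ncost v)%N.
  by case: ifP => _; [apply: leq_trans (IH1 _ _ _ b1) _
                     |apply: leq_trans (IH2 _ _ _ b2) _]; lia.
- case=> b1 b2.
  have h := two p1 p2 (nesting p1) (nesting p2) (1 + rcost u + rcost v)%N.
  by case: ifP => _; [apply: leq_trans (IH1 _ _ _ b1) _
                     |apply: leq_trans (IH2 _ _ _ b2) _]; lia.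
case=> bu b1.
suff loop ks s0 t0 : {in ks, forall k, (k < neval e u)%N} ->
    ((foldl (fun st' k => exec p1 (set_env e x k) (st'.1, st'.2.+1))
        (s0, t0) ks).2
     <= t0 + size ks * (1 + steps p1 * N ^ nesting p1))%N.
  apply: leq_trans (loop _ _ _ _) _.
    by move=> k; rewrite mem_iota.
  rewrite size_iota expnS.
  have Ng0 : (0 < N ^ nesting p1)%N by rewrite expn_gt0 N0.
  have : (neval e u * (1 + steps p1 * N ^ nesting p1) <=
          N * (1 + steps p1 * N ^ nesting p1))%N by rewrite leq_mul2r bu orbT.
  have : (N <= N * N ^ nesting p1)%N by rewrite leq_pmulr.
  have : (1 + ncost u <= (1 + ncost u) * (N * N ^ nesting p1))%N.
    by rewrite leq_pmulr // muln_gt0 N0.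
  move: (N ^ _)%N Ng0.
  move: (neval e u) (steps p1) (ncost u) => a b c Y _.
  by clear; nia.
elim: ks s0 t0 => [|k ks IH] s0 t0 lt /=; first by rewrite addn0.
case E: (exec p1 _ _) => [s' t'].
have := IH1 (set_env e x k) s0 t0.+1 (b1 _ (lt _ (mem_head _ _))).
rewrite E /= => le.
apply: leq_trans (IH _ _ _) _; last first.
  by rewrite mulSn addnA leq_add2r add1n -addSnnS.
by move=> k' ks'; apply: lt; rewrite inE ks' orbT.
Qed.

(** The time counter never influences the memory, so that programs can be
    reasoned about as memory transformers. *)
Definition run p e s : Defs.mem R := (exec p e (s, 0%N)).1.

Lemma exec_run p e s t : (exec p e (s, t)).1 = run p e s.
Proof.
suff h t1 t2 : (exec p e (s, t1)).1 = (exec p e (s, t2)).1 by apply: h.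
elim: p e s t1 t2 => [|p1 IH1 p2 IH2|g a ts u|u v p1 IH1 p2 IH2
    |u v p1 IH1 p2 IH2|x u p1 IH1] e s t1 t2 //=.
- have := IH1 e s t1 t2.
  by case: (exec p1 e _) => [s1 t1'] /=; case: (exec p1 e _) => [s2 t2'] /= ->.
- by case: ifP.
- by case: ifP.
elim: (iota _ _) s (t1 + _)%N (t2 + _)%N => [|k ks IH] s' t1' t2' //=.
have := IH1 (set_env e x k) s' t1'.+1 t2'.+1.
case: (exec p1 _ _) => [s1 t3] /=; case: (exec p1 _ _) => [s2 t4] /= ->.
exact: IH.
Qed.

Lemma run_seq p1 p2 e s : run (Seq p1 p2) e s = run p2 e (run p1 e s).
Proof. by rewrite /run /=; case: (exec p1 e _) => [s' t]; apply: exec_run. Qed.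

Lemma run_for x u p1 e s : run (For x u p1) e s =
  foldl (fun s' k => run p1 (set_env e x k) s') s (iota 0 (neval e u)).
Proof.
rewrite {1}/run /=; elim: (iota _ _) s (0 + _)%N => [|k ks IH] s t //=.
rewrite -[run _ _ s](exec_run _ _ _ t.+1).
by case: (exec p1 _ _) => s' t'; apply: IH.
Qed.

Lemma for_invariant (I : nat -> Defs.mem R -> Prop) x u p1 e s :
  I 0%N s ->
  (forall k s', (k < neval e u)%N -> I k s' ->
     I k.+1 (run p1 (set_env e x k) s')) ->
  I (neval e u) (run (For x u p1) e s).
Proof.
move=> I0 IS; rewrite run_for.
suff h N : (N <= neval e u)%N ->
  I N (foldl (fun s' k => run p1 (set_env e x k) s') s (iota 0 N)) by apply: h.
elim: N => [|N IH] le //; rewrite -addn1 iotaD foldl_cat /= addn1 add0n.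
by apply: IS => //; apply/IH/ltnW.
Qed.

Fixpoint writes (g : region) (a : nat) p : bool :=
  match p with
  | Skip => false
  | Seq p1 p2 | IfN _ _ p1 p2 | IfR _ _ p1 p2 => writes g a p1 || writes g a p2
  | Set_ g' a' _ _ => region_eqb g g' && (a == a')
  | For _ _ p1 => writes g a p1
  end.

Lemma run_frame g a p e s : ~~ writes g a p -> run p e s g a = s g a.
Proof.
elim: p e s => [|p1 IH1 p2 IH2|g' a' ts u|u v p1 IH1 p2 IH2|u v p1 IH1 p2 IH2
    |x u p1 IH1] e s //=.
- by rewrite negb_or run_seq => /andP[w1 w2]; rewrite IH2 ?IH1.
- by rewrite /run /= /set_mem; case: (region_eqb g g'); case: (a == a').
- rewrite negb_or => /andP[w1 w2]; rewrite /run /=.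
  by case: ifP => _; rewrite exec_run ?IH1 ?IH2.
- rewrite negb_or => /andP[w1 w2]; rewrite /run /=.
  by case: ifP => _; rewrite exec_run ?IH1 ?IH2.
move=> w; rewrite run_for; elim: (iota _ _) s => [|k ks IH] s //=.
by rewrite IH IH1.
Qed.

End Programs.

(** Loop nests around a single instruction that adds a value to a cell of a
    fixed array.  As memory that has not been written holds 0, assignments to
    fresh cells also have this form. *)
Inductive nest := Add of seq nexp & rexp | Loop of nat & nexp & nest.

Fixpoint add_nest (g : region) (a : nat) (b : nest) : cmd :=
  match b with
  | Add ts u => Set_ g a ts (RAdd (RGet g a ts) u)
  | Loop x u b' => For x u (add_nest g a b')
  end.

Fixpoint reads (g : region) (a : nat) (u : rexp) : bool :=
  match u with
  | RConst _ => false
  | RGet g' a' _ => region_eqb g' g && (a' == a)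
  | RAdd t1 t2 | RSub t1 t2 | RMul t1 t2 | RDiv t1 t2 =>
      reads g a t1 || reads g a t2
  end.

Fixpoint nest_reads (g : region) (a : nat) (b : nest) : bool :=
  match b with
  | Add _ u => reads g a u
  | Loop _ _ b' => nest_reads g a b'
  end.

Section LoopNests.
Variable R : realFieldType.
Implicit Types (b : nest) (e : env) (s : Defs.mem R) (idx : seq nat).

Fixpoint nest_sum b e s idx : R :=
  match b with
  | Add ts u => if map (neval e) ts == idx then reval e s u else 0
  | Loop x u b' => \sum_(k < neval e u) nest_sum b' (set_env e x k) s idx
  end.

Lemma reval_frame g a u e s s' : ~~ reads g a u ->
  (forall g' a' idx, ~~ (region_eqb g' g && (a' == a)) ->
     s g' a' idx = s' g' a' idx) ->
  reval e s u = reval e s' u.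
Proof.
move=> + es; elim: u => [z|g' a' ts|u IHu v IHv|u IHu v IHv|u IHu v IHv
    |u IHu v IHv] //=.
- exact: es.
all: by rewrite negb_or => /andP[/IHu-> /IHv->].
Qed.

Lemma nest_sum_frame g a b e s s' idx : ~~ nest_reads g a b ->
  (forall g' a' idx, ~~ (region_eqb g' g && (a' == a)) ->
     s g' a' idx = s' g' a' idx) ->
  nest_sum b e s idx = nest_sum b e s' idx.
Proof.
move=> + es; elim: b e => [ts u|x u b IH] e /= nr; last first.
  by apply: eq_bigr => k _; apply: IH.
by rewrite (reval_frame e nr es).
Qed.

Lemma region_eqbb g : region_eqb g g. Proof. by case: g. Qed.

Lemma writes_add_nest g a b g' a' :
  writes g' a' (add_nest g a b) = region_eqb g' g && (a' == a).
Proof. by elim: b. Qed.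

(** Since the array (g, a) is not read by the added values, these do not change
    while the nest runs, and the order of the additions does not matter. *)
Lemma run_add_nest g a b e s idx : ~~ nest_reads g a b ->
  run (add_nest g a b) e s g a idx = s g a idx + nest_sum b e s idx.
Proof.
elim: b e s => [ts u|x u b IH] e s /= nr.
  rewrite /run /= /set_mem region_eqbb eqxx /= eq_sym.
  by case: eqP => [<-|]; rewrite ?addr0.
rewrite run_for -(big_mkord xpredT (fun k => nest_sum b (set_env e x k) s idx)).
rewrite /index_iota subn0.
elim: (iota _ _) s => [|k ks IHk] s /=; first by rewrite big_nil addr0.
rewrite IHk IH // big_cons addrA; congr (_ + _).
apply: eq_bigr => k' _; apply: nest_sum_frame nr _ => g' a' idx' ne.
by rewrite run_frame // writes_add_nest.
Qed.

Lemma nest_sum_add ts u e s idx :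
  map (neval e) ts = idx -> nest_sum (Add ts u) e s idx = reval e s u.
Proof. by move=> /= ->; rewrite eqxx. Qed.

Lemma nest_sum_sum x u b e s idx N F :
  neval e u = N ->
  (forall k, (k < N)%N -> nest_sum b (set_env e x k) s idx = F k) ->
  nest_sum (Loop x u b) e s idx = \sum_(k < N) F k.
Proof. by move=> /= -> tF; apply: eq_bigr => k _; apply: tF. Qed.

(** For a loop variable that occurs among the indices of the cell written: only
    one iteration reaches the given cell. *)
Lemma nest_sum_pick x u b e s idx N k0 v :
  neval e u = N -> (k0 < N)%N ->
  (forall k, (k < N)%N -> k <> k0 -> nest_sum b (set_env e x k) s idx = 0) ->
  nest_sum b (set_env e x k0) s idx = v ->
  nest_sum (Loop x u b) e s idx = v.
Proof.
move=> /= -> ltk0 t0 <-.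
apply: (sum_pick (F := fun k => nest_sum b (set_env e x k) s idx)) => // k ltk.
by move/eqP; apply: t0.
Qed.

End LoopNests.

(** For cells that a nest does not reach: the indices of the instruction never
    match theirs, whatever the loop variables. *)
Ltac miss :=
  cbn [nest_sum]; repeat (rewrite big1 //; intros ? _; cbn [nest_sum]);
  case: eqP => // -[]; rewrite /set_env /=; intros; exfalso; lia.

(** * The Gram-Schmidt program *)

(** Row k of aU is the direction u_k, and aV receives it while it is computed
    from the rows of aU that are already complete.  The cell (i, k) of aG is
    (Q u_k)_i, so that the diagonal holds the squared lengths s_k.  Row k of aP
    is A u_k.  Row l of aH is the sum over k > l of (A u_k) (Q u_k)_l / s_k, which
    enters the change of the linear dual objective when the variable of index l
    is fixed.  The array agam of a node holds the products u_k^T c(r). *)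
Definition aU : nat := 9.
Definition aV : nat := 10.
Definition aG : nat := 11.
Definition aP : nat := 12.
Definition aH : nat := 13.
Definition agam : nat := 14.

Definition gram_schmidt : cmd :=
  let n := NVar 0 in
  let k := NSub (NSub n (NVar 4)) (NConst 1) in
  let j := NAdd (NSub n (NVar 4)) (NVar 5) in
  For 4 n
   (Seq (add_nest Pre aV (Add [:: k; k] (RConst 1)))
   (Seq (add_nest Pre aV (Loop 5 (NVar 4) (Loop 6 n
           (Add [:: k; NVar 6]
              (RSub (RConst 0)
                 (RDiv (RMul (RGet Pre aU [:: j; NVar 6])
                             (RGet Pre aG [:: k; j]))
                       (RGet Pre aG [:: j; j])))))))
   (Seq (add_nest Pre aU (Loop 6 n
           (Add [:: k; NVar 6] (RGet Pre aV [:: k; NVar 6]))))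
        (add_nest Pre aG (Loop 5 n (Loop 6 n
           (Add [:: NVar 5; k]
              (RMul (RGet Input aQ [:: NVar 5; NVar 6])
                    (RGet Pre aU [:: k; NVar 6]))))))))).

Section GramSchmidt.
Variable R : realFieldType.

(** After t iterations the last t directions and the corresponding columns of aG
    are complete and the remaining ones are still zero; the invariant I says
    this. *)
Lemma gram_schmidt_run n (q : nat -> nat -> R) e (s : Defs.mem R) :
  (forall i j, q i j = q j i) ->
  (forall x, (exists2 i, (i < n)%N & x i != 0) ->
     0 < dot n x (fun i => dot n (q i) x)) ->
  e 0%N = n ->
  (forall i j, s Input aQ [:: i; j] = q i j) ->
  (forall idx, s Pre aU idx = 0) -> (forall idx, s Pre aV idx = 0) ->
  (forall idx, s Pre aG idx = 0) ->
  let s' := run gram_schmidt e s in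
  let u k j := s' Pre aU [:: k; j] in
  conjugate n 0 q u /\
  forall i k, (i < n)%N -> (k < n)%N -> s' Pre aG [:: i; k] = dot n (q i) (u k).
Proof.
move=> qC qpos e0 sQ sU sV sG.
pose I t (s' : Defs.mem R) :=
  let u k j := s' Pre aU [:: k; j] in
  [/\ forall i j, s' Input aQ [:: i; j] = q i j,
      forall k j, (k < n - t)%N ->
        [/\ u k j = 0, s' Pre aV [:: k; j] = 0 & s' Pre aG [:: j; k] = 0],
      conjugate n (n - t) q u &
      forall i k, (i < n)%N -> (n - t <= k < n)%N ->
        s' Pre aG [:: i; k] = dot n (q i) (u k)].
suff : I n (run gram_schmidt e s).
  rewrite /I subnn => -[_ _ cu G]; split=> // i k li lk; exact: G.
rewrite -[X in I X]e0; apply: (for_invariant (I := I)).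
  split=> //; rewrite subn0.
  - by move=> k; case/andP=> nk kn; lia.
  - by move=> i k _; lia.
move=> t s0 ltn [Q Z cu G]; have {ltn} ltn : (t < n)%N by rewrite -e0.
rewrite !run_seq.
set e' := set_env e 4 t.
have e'0 : e' 0%N = n by [].
have e'4 : e' 4%N = t by [].
set s1 := run _ _ s0; set s2 := run _ _ s1.
set s3 := run _ _ s2; set s4 := run _ _ s3.
(* the index of the direction computed in this iteration *)
set l := (n - t.+1)%N.
pose w k j := s0 Pre aU [:: k; j].
have lE : (n - t - 1)%N = l by lia.
have ltl : (l < n)%N by lia.
have Zl j : (s0 Pre aU [:: l; j] = 0) * (s0 Pre aV [:: l; j] = 0) *
    (s0 Pre aG [:: j; l] = 0).
  by have [] := Z l j; first lia.
(* contents of arrays that the intermediate steps leave alone *)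
have f1U : s1 Pre aU = s0 Pre aU by apply: run_frame.
have f1G : s1 Pre aG = s0 Pre aG by apply: run_frame.
have f2U : s2 Pre aU = s0 Pre aU by rewrite -f1U; apply: run_frame.
have f2G : s2 Pre aG = s0 Pre aG by rewrite -f1G; apply: run_frame.
have f3V : s3 Pre aV = s2 Pre aV by apply: run_frame.
have f3G : s3 Pre aG = s0 Pre aG by rewrite -f2G; apply: run_frame.
have f4V : s4 Pre aV = s2 Pre aV by rewrite -f3V; apply: run_frame.
have f4U : s4 Pre aU = s3 Pre aU by apply: run_frame.
have f3Q : s3 Input aQ = s0 Input aQ by rewrite /s3 /s2 /s1 !run_frame.
have f4Q : s4 Input aQ = s0 Input aQ by rewrite -f3Q; apply: run_frame.
have V1 j : s1 Pre aV [:: l; j] = (j == l)%:R.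
  rewrite /s1 run_add_nest // Zl add0r.
  case: eqP => [->|ne]; last by miss.
  by rewrite nest_sum_add //= e'0 e'4 lE.
have V2 j : (j < n)%N -> s2 Pre aV [:: l; j] = (j == l)%:R -
    \sum_(l.+1 <= k < n) w k j * dot n (q l) (w k) / dot n (q k) (w k).
  move=> jn; rewrite /s2 run_add_nest // V1; congr (_ + _).
  pose F k := w k j * dot n (q l) (w k) / dot n (q k) (w k).
  rewrite -(sum_shift n l.+1 F) -sumrN.
  have -> : (n - l.+1)%N = t by lia.
  apply: (nest_sum_sum (F := fun k => - F (l.+1 + k)%N)) => // k kt.
  apply: (nest_sum_pick (N := n) (k0 := j)) => //.
    by move=> j' _ nej; miss.
  rewrite nest_sum_add /set_env /= e'0 e'4 lE // f1U f1G.
  have -> : (n - t + k = l.+1 + k)%N by lia.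
  by rewrite !G; [rewrite sub0r|lia..].
have U3 j : (j < n)%N -> s3 Pre aU [:: l; j] = s2 Pre aV [:: l; j].
  move=> jn; rewrite /s3 run_add_nest // f2U Zl add0r.
  apply: (nest_sum_pick (N := n) (k0 := j)) => //.
    by move=> j' _ nej; miss.
  by rewrite nest_sum_add /set_env /= e'0 e'4 lE.
have G4 i : (i < n)%N ->
    s4 Pre aG [:: i; l] = dot n (q i) (fun j => s3 Pre aU [:: l; j]).
  move=> li; rewrite /s4 run_add_nest // f3G Zl add0r.
  apply: (nest_sum_pick (N := n) (k0 := i)) => //.
    by move=> j' _ nej; miss.
  apply: (nest_sum_sum (F := fun j => q i j * s3 Pre aU [:: l; j])) => // j _.
  by rewrite nest_sum_add /set_env /= e'0 e'4 lE // f3Q Q.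
(* cells that belong to the other directions keep their values *)
have oU k j : k <> l -> s4 Pre aU [:: k; j] = s0 Pre aU [:: k; j].
  move=> ne; rewrite f4U /s3 run_add_nest // f2U.
  by rewrite [nest_sum _ _ _ _](_ : _ = 0) ?addr0 //; miss.
have oV k j : k <> l -> s4 Pre aV [:: k; j] = s0 Pre aV [:: k; j].
  move=> ne; rewrite f4V /s2 run_add_nest // /s1 run_add_nest //.
  rewrite [nest_sum _ _ s0 _](_ : _ = 0); last by miss.
  by rewrite [nest_sum _ _ _ _](_ : _ = 0) ?addr0 //; miss.
have oG i k : k <> l -> s4 Pre aG [:: i; k] = s0 Pre aG [:: i; k].
  move=> ne; rewrite /s4 run_add_nest // f3G.
  by rewrite [nest_sum _ _ _ _](_ : _ = 0) ?addr0 //; miss.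
have cu' : conjugate n l.+1 q (fun k j => s4 Pre aU [:: k; j]).
  have -> : l.+1 = (n - t)%N by lia.
  by apply: eq_conjugate cu => k j lk; apply: oU; lia.
have du k x : (l < k)%N ->
    dot n x (fun j => s4 Pre aU [:: k; j]) = dot n x (w k).
  by move=> lk; apply: eq_dot => j _; apply: oU; lia.
split.
- by move=> i j; rewrite f4Q.
- move=> k j lk; rewrite oU ?oV ?oG; try lia; apply: Z; lia.
- apply: (gram_schmidt_step qC qpos ltl cu') => j jn.
  rewrite f4U U3 // V2 //; congr (_ - _); apply: eq_big_nat => k rk.
  by rewrite -f4U oU ?du //; lia.
move=> i k li rk; case: (k =P l) => [kl|ne].
  by rewrite kl G4 // f4U.
by rewrite oG // du ?G //; lia.
Qed.
End GramSchmidt.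

(** * The dual problem at a node *)

Lemma cell1E (R : zmodType) n (f : 'I_n -> R) (i : 'I_n) : cell1 f i = f i.
Proof. by rewrite /cell1 valK. Qed.

Section Problem.
Variables (R : realFieldType) (n m : nat) (P : miqp R n m).
Implicit Types (r : seq int) (u : nat -> nat -> R).

(** Coefficients extended by 0 outside their range, exactly as the input arrays
    store them. *)
Definition entryQ i j : R := cell1 (fun i' => cell1 (objQ P i') j) i.
Definition entryc j : R := cell1 (fun j' => objc P j' 0) j.
Definition entryA k j : R := cell1 (fun k' => cell1 (conA P k') j) k.
Definition entryb k : R := cell1 (fun k' => conb P k' 0) k.

Lemma entryQC i j : posdef (objQ P) -> entryQ i j = entryQ j i.
Proof.
case=> QT _; rewrite /entryQ /cell1.
by case: (insub i) => [?|]; case: (insub j) => [?|] //; rewrite -[in LHS]QT mxE.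
Qed.

Lemma entryQ_gt0 x : posdef (objQ P) -> (exists2 i, (i < n)%N & x i != 0) ->
  0 < dot n x (fun i => dot n (entryQ i) x).
Proof.
case=> _ Qpos [i lti xi].
suff -> : dot n x (fun i => dot n (entryQ i) x) =
    ((\col_(j < n) x j)^T *m objQ P *m (\col_(j < n) x j)) 0 0.
  apply: Qpos; apply/eqP => /colP /(_ (Ordinal lti)); rewrite !mxE /=.
  exact/eqP.
rewrite -mulmxA mxE; apply: eq_bigr => k _; rewrite !mxE; congr (_ * _).
by apply: eq_bigr => j _; rewrite !mxE /entryQ !cell1E.
Qed.

Definition node_c r j : R :=
  entryc j + 2 * \sum_(i < size r) entryQ i j * (r`_i)%:~R.
Definition node_d r : R :=
  objd P + \sum_(i < size r) entryc i * (r`_i)%:~R +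
  \sum_(i < size r) \sum_(j < size r) entryQ i j * (r`_i)%:~R * (r`_j)%:~R.
Definition node_b r k : R :=
  entryb k - \sum_(i < size r) (r`_i)%:~R * entryA k i.

Lemma reducedE r : (size r <= n)%N ->
  [/\ objQ (reduced P r) = trailing n (size r) entryQ,
      forall j, objc (reduced P r) j 0 = node_c r (size r + j),
      objd (reduced P r) = node_d r,
      forall k j, conA (reduced P r) k j = entryA k (size r + j)
    & forall k : 'I_m, conb (reduced P r) k 0 = node_b r k].
Proof.
move=> le.
have Qe (i j : 'I_n) : objQ P i j = entryQ i j by rewrite /entryQ !cell1E.
have ce (i : 'I_n) : objc P i 0 = entryc i by rewrite /entryc cell1E.
have Ae k (j : 'I_n) : conA P k j = entryA k j.
  by rewrite /entryA !cell1E.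
have widen (F : nat -> R) :
    \sum_(i < n | (i < size r)%N) F i = \sum_(i < size r) F i.
  by rewrite -big_ord_widen.
split=> [|j||k j|k].
- by apply/matrixP => i j; rewrite !mxE Qe.
- rewrite mxE ce /node_c -(widen (fun i => entryQ i _ * (r`_i)%:~R)).
  by congr (_ + 2 * _); apply: eq_bigr => i _; rewrite Qe.
- rewrite /= /node_d -(widen (fun i => entryc i * (r`_i)%:~R)).
  rewrite -(widen (fun i =>
    \sum_(j < size r) entryQ i j * (r`_i)%:~R * (r`_j)%:~R)).
  congr (_ + _ + _); first by apply: eq_bigr => i _; rewrite ce.
  apply: eq_bigr => i _.
  rewrite -(widen (fun j => entryQ i j * (r`_i)%:~R * (r`_j)%:~R)).
  by apply: eq_bigr => j _; rewrite Qe.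
- by rewrite mxE Ae.
rewrite mxE /node_b -(widen (fun i => (r`_i)%:~R * entryA k i)) /entryb cell1E.
by congr (_ - _); apply: eq_bigr => i _; rewrite Ae.
Qed.

Lemma node_c_rcons r v j :
  node_c (rcons r v) j = node_c r j + 2 * v%:~R * entryQ (size r) j.
Proof.
rewrite /node_c size_rcons big_ord_recr /= nth_rcons ltnn eqxx.
under eq_bigr => i _ do rewrite nth_rcons ltn_ord.
ring.
Qed.

Lemma node_b_rcons r v k :
  node_b (rcons r v) k = node_b r k - v%:~R * entryA k (size r).
Proof.
rewrite /node_b size_rcons big_ord_recr /= nth_rcons ltnn eqxx.
under eq_bigr => i _ do rewrite nth_rcons ltn_ord.
ring.
Qed.

(** The two mixed products of v with the earlier values agree because Q is
    symmetric; they are the part of node_c that depends on r. *)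
Lemma node_d_rcons r v : posdef (objQ P) ->
  node_d (rcons r v) = node_d r +
    v%:~R * (node_c r (size r) + v%:~R * entryQ (size r) (size r)).
Proof.
move=> Qpos; rewrite /node_d /node_c size_rcons !big_ord_recr /=.
rewrite !nth_rcons ltnn eqxx.
under eq_bigr => i _ do rewrite nth_rcons ltn_ord.
under [X in _ + _ + (X + _) = _]eq_bigr => i _.
  rewrite big_ord_recr /= !nth_rcons ltnn eqxx ltn_ord.
  under eq_bigr => j _ do rewrite nth_rcons ltn_ord.
  over.
under [X in _ + _ + (_ + (X + _)) = _]eq_bigr => i _.
  rewrite nth_rcons ltn_ord entryQC // mulrAC.
  over.
rewrite big_split /= -!mulr_suml.
ring.
Qed.

(** Entries of the linear part and constant of the dual, expressed by the
    conjugate directions. *)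
Definition dual_lin u r k : R :=
  \sum_(size r <= t < n)
    dot n (entryA k) (u t) * dot n (node_c r) (u t) /
      (2 * dot n (entryQ t) (u t)) +
  node_b r k.
Definition dual_cst u r : R :=
  \sum_(size r <= t < n)
    dot n (node_c r) (u t) * dot n (node_c r) (u t) /
      (4 * dot n (entryQ t) (u t)) -
  node_d r.

Lemma conjugateW l u : conjugate n 0 entryQ u -> conjugate n l entryQ u.
Proof. by move=> cu k /andP[_ kn]; apply: cu. Qed.

(** Each part of the dual is a product X Q_l^-1 Y, where X and Y are built from
    the trailing parts of rows of A and of c(r). *)
Lemma relaxation_dualE u r : posdef (objQ P) -> conjugate n 0 entryQ u ->
  (size r <= n)%N ->
  let D := relaxation_dual (reduced P r) in
  [/\ forall i j : 'I_m, dualQ D i j = \sum_(size r <= t < n)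
        dot n (entryA i) (u t) * dot n (entryA j) (u t) /
          (4 * dot n (entryQ t) (u t)),
      forall i : 'I_m, dualc D i 0 = dual_lin u r i
    & duald D = dual_cst u r].
Proof.
move=> Qpos cu le D.
have [rQ rc rd rA rb] := reducedE le.
have [_ bil] := trailing_inv (fun i j => entryQC i j Qpos)
  (conjugateW (l := size r) cu).
split=> [i j|i|].
- rewrite mxE rQ (bil _ _ _ _ _ _ (entryA i) (entryA j)) //; last first.
    by move=> t; rewrite [LHS]mxE; apply: rA.
  by rewrite mulr_sumr; apply: eq_bigr => t _; rewrite invfM; ring.
- rewrite mxE [X in X + _]mxE rQ (bil _ _ _ _ _ _ (entryA i) (node_c r)) //.
  rewrite rb /dual_lin mulr_sumr.
  by congr (_ + _); apply: eq_bigr => t _; rewrite invfM; ring.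
rewrite [duald D]/(4^-1 * ((objc (reduced P r))^T *m invmx (objQ (reduced P r)) *m
  objc (reduced P r)) 0 0 - objd (reduced P r)).
rewrite rQ rd (bil _ _ _ _ _ _ (node_c r) (node_c r)) //; last first.
  by move=> t; rewrite [LHS]mxE; apply: rc.
rewrite /dual_cst mulr_sumr.
by congr (_ - _); apply: eq_bigr => t _; rewrite invfM; ring.
Qed.

Lemma dot_node_c_rcons u r v k : dot n (node_c (rcons r v)) (u k) =
  dot n (node_c r) (u k) + 2 * v%:~R * dot n (entryQ (size r)) (u k).
Proof.
rewrite /dot mulr_sumr -big_split; apply: eq_bigr => j _.
by rewrite node_c_rcons /=; ring.
Qed.

(** In the sum over the directions, the one of index [size r] drops out, and
    each later product u_t^T c(r) grows by 2 v (Q u_t)_[size r]. *)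
Lemma dual_lin_rcons u r v k : (size r < n)%N ->
  dual_lin u (rcons r v) k = dual_lin u r k -
    dot n (entryA k) (u (size r)) * dot n (node_c r) (u (size r)) /
      (2 * dot n (entryQ (size r)) (u (size r))) +
    v%:~R * (\sum_((size r).+1 <= t < n) dot n (entryA k) (u t) *
               dot n (entryQ (size r)) (u t) / dot n (entryQ t) (u t)
             - entryA k (size r)).
Proof.
move=> lt; rewrite /dual_lin node_b_rcons size_rcons.
rewrite [X in _ = X + _ - _ + _](big_ltn lt).
have -> : \sum_((size r).+1 <= t < n) dot n (entryA k) (u t) *
      dot n (node_c (rcons r v)) (u t) / (2 * dot n (entryQ t) (u t)) =
    \sum_((size r).+1 <= t < n) dot n (entryA k) (u t) *
      dot n (node_c r) (u t) / (2 * dot n (entryQ t) (u t)) +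
    v%:~R * \sum_((size r).+1 <= t < n) dot n (entryA k) (u t) *
               dot n (entryQ (size r)) (u t) / dot n (entryQ t) (u t).
  rewrite mulr_sumr -big_split; apply: eq_bigr => t _ /=.
  rewrite dot_node_c_rcons invfM.
  by move: (dot n (entryQ t) (u t))^-1 => w; field.
ring.
Qed.

End Problem.

(** * The preprocessing and node programs *)

Definition image_code : cmd :=
  add_nest Pre aP (Loop 4 (NVar 0) (Loop 5 (NVar 1) (Loop 6 (NVar 0)
    (Add [:: NVar 4; NVar 5]
       (RMul (RGet Input aA [:: NVar 5; NVar 6])
             (RGet Pre aU [:: NVar 4; NVar 6])))))).

Definition shift_code : cmd :=
  let k := NAdd (NAdd (NVar 4) (NConst 1)) (NVar 6) in
  add_nest Pre aH (Loop 4 (NVar 0) (Loop 5 (NVar 1)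
    (Loop 6 (NSub (NVar 0) (NAdd (NVar 4) (NConst 1)))
    (Add [:: NVar 4; NVar 5]
       (RDiv (RMul (RGet Pre aP [:: k; NVar 5]) (RGet Pre aG [:: NVar 4; k]))
             (RGet Pre aG [:: k; k])))))).

Definition dualQ_code : cmd :=
  let k := NAdd (NVar 4) (NVar 7) in
  add_nest Pre out_dualQ (Loop 4 (NVar 0) (Loop 5 (NVar 1) (Loop 6 (NVar 1)
    (Loop 7 (NSub (NVar 0) (NVar 4))
    (Add [:: NVar 4; NVar 5; NVar 6]
       (RDiv (RMul (RGet Pre aP [:: k; NVar 5]) (RGet Pre aP [:: k; NVar 6]))
             (RMul (RConst 4) (RGet Pre aG [:: k; k])))))))).

(** Shared by the root and the other nodes: index variable 3 holds the depth. *)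
Definition duald_code : cmd :=
  let k := NAdd (NVar 3) (NVar 4) in
  Seq (add_nest Node out_duald (Loop 4 (NSub (NVar 0) (NVar 3))
        (Add [::] (RDiv (RMul (RGet Node agam [:: k]) (RGet Node agam [:: k]))
                        (RMul (RConst 4) (RGet Pre aG [:: k; k]))))))
      (add_nest Node out_duald
        (Add [::] (RSub (RConst 0) (RGet Node ad [::])))).

Definition root_code : cmd :=
  Seq (add_nest Node agam (Loop 4 (NVar 0) (Loop 5 (NVar 0)
        (Add [:: NVar 4]
           (RMul (RGet Input ac [:: NVar 5])
                 (RGet Pre aU [:: NVar 4; NVar 5]))))))
  (Seq (add_nest Node ac (Loop 4 (NVar 0)
        (Add [:: NVar 4] (RGet Input ac [:: NVar 4]))))
  (Seq (add_nest Node ad (Add [::] (RGet Input ad [::])))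
  (Seq (add_nest Node out_dualc (Loop 4 (NVar 1)
        (Add [:: NVar 4] (RGet Input ab [:: NVar 4]))))
  (Seq (add_nest Node out_dualc (Loop 4 (NVar 1) (Loop 5 (NVar 0)
        (Add [:: NVar 4]
           (RDiv (RMul (RGet Pre aP [:: NVar 5; NVar 4])
                       (RGet Node agam [:: NVar 5]))
                 (RMul (RConst 2) (RGet Pre aG [:: NVar 5; NVar 5])))))))
       duald_code)))).

Definition pre_code : cmd :=
  Seq gram_schmidt (Seq image_code (Seq shift_code (Seq dualQ_code root_code))).

(** Here i is the variable that has just been fixed, and v its value. *)
Definition node_code : cmd :=
  let i := NSub (NVar 3) (NConst 1) in
  let k := NAdd (NVar 3) (NVar 4) in
  let v := RGet Input aval [::] in
  Seq (add_nest Node agam (Loop 4 (NSub (NVar 0) (NVar 3))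
        (Add [:: k] (RAdd (RGet Parent agam [:: k])
           (RMul (RMul (RConst 2) v) (RGet Pre aG [:: i; k]))))))
  (Seq (add_nest Node ac (Loop 4 (NSub (NVar 0) (NVar 3))
        (Add [:: k] (RAdd (RGet Parent ac [:: k])
           (RMul (RMul (RConst 2) v) (RGet Input aQ [:: i; k]))))))
  (Seq (add_nest Node ad (Add [::] (RAdd (RGet Parent ad [::])
           (RMul v (RAdd (RGet Parent ac [:: i])
                         (RMul v (RGet Input aQ [:: i; i])))))))
  (Seq (add_nest Node out_dualc (Loop 4 (NVar 1)
        (Add [:: NVar 4]
           (RAdd (RSub (RGet Parent out_dualc [:: NVar 4])
                    (RDiv (RMul (RGet Pre aP [:: i; NVar 4])
                                (RGet Parent agam [:: i]))
                          (RMul (RConst 2) (RGet Pre aG [:: i; i]))))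
                 (RMul v (RSub (RGet Pre aH [:: i; NVar 4])
                               (RGet Input aA [:: NVar 4; i])))))))
       duald_code))).

Section Correctness.
Variables (R : realFieldType) (n m : nat) (P : miqp R n m).
Implicit Types (r : seq int) (u : nat -> nat -> R) (pre node : regmem R).

(** The directions are a parameter, so that [prepared] and [up_to_date] speak of
    the same ones at all nodes. *)
Record prepared u pre : Prop := Prepared {
  prep_conj : conjugate n 0 (entryQ P) u;
  prep_U : forall k j, pre aU [:: k; j] = u k j;
  prep_G : forall i k, (i < n)%N -> (k < n)%N ->
    pre aG [:: i; k] = dot n (entryQ P i) (u k);
  prep_P : forall k i, (k < n)%N -> (i < m)%N ->
    pre aP [:: k; i] = dot n (entryA P i) (u k);
  prep_H : forall l i, (l < n)%N -> (i < m)%N ->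
    pre aH [:: l; i] = \sum_(l.+1 <= t < n) dot n (entryA P i) (u t) *
      dot n (entryQ P l) (u t) / dot n (entryQ P t) (u t);
  prep_dualQ : forall l i j, (l < n)%N -> (i < m)%N -> (j < m)%N ->
    pre out_dualQ [:: l; i; j] = \sum_(l <= t < n)
      dot n (entryA P i) (u t) * dot n (entryA P j) (u t) /
        (4 * dot n (entryQ P t) (u t)) }.

(** Besides the dual data this fixes the auxiliary data; they concern only the
    free variables, since the entries of fixed variables are not maintained. *)
Record up_to_date u r node : Prop := UpToDate {
  node_gam : forall k, (size r <= k < n)%N ->
    node agam [:: k] = dot n (node_c P r) (u k);
  node_ac : forall j, (size r <= j < n)%N -> node ac [:: j] = node_c P r j;
  node_ad : node ad [::] = node_d P r;
  node_dualc : forall i, (i < m)%N -> node out_dualc [:: i] = dual_lin P u r i;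
  node_duald : node out_duald [::] = dual_cst P u r }.

Lemma eq_prepared u pre pre' : (forall a, pre' a = pre a) ->
  prepared u pre -> prepared u pre'.
Proof.
by move=> e [cu U G Pk H dQ]; split=> // *; rewrite e ?U ?G ?Pk ?H ?dQ.
Qed.

Lemma run_duald u r (e : env) (s : Defs.mem R) :
  e 0%N = n -> e 3%N = size r -> prepared u (s Pre) ->
  (forall k, (size r <= k < n)%N ->
     s Node agam [:: k] = dot n (node_c P r) (u k)) ->
  s Node ad [::] = node_d P r -> s Node out_duald [::] = 0 ->
  run duald_code e s Node out_duald [::] = dual_cst P u r.
Proof.
move=> e0 e3 pre gam d z; rewrite run_seq run_add_nest // run_add_nest //.
rewrite z add0r nest_sum_add // [reval _ _ _]/= run_frame // d sub0r.
congr (_ - _).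
rewrite -(sum_shift n (size r) (fun t => dot n (node_c P r) (u t) *
  dot n (node_c P r) (u t) / (4 * dot n (entryQ P t) (u t)))).
apply: (nest_sum_sum (F := fun k => dot n (node_c P r) (u (size r + k)%N) *
  dot n (node_c P r) (u (size r + k)%N) /
  (4 * dot n (entryQ P (size r + k)%N) (u (size r + k)%N)))).
  by rewrite /= e0 e3.
move=> k lk; rewrite nest_sum_add // /set_env /= e3 gam; last by lia.
by rewrite (prep_G pre) //; lia.
Qed.

(** At the root the fixing is empty, so that the auxiliary data are those of the
    input. *)
Lemma run_preprocessing : posdef (objQ P) ->
  exists u, prepared u (pre_data pre_code P) /\
            up_to_date u [::] ((run_pre pre_code P).1 Node).
Proof.
move=> Qpos.
rewrite /pre_data /run_pre exec_run /pre_code 4!run_seq.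
set e := init_env P 0; set s := init_mem _ _ _ _.
have e0 : e 0%N = n by [].
have e1 : e 1%N = m by [].
have sQ i j : s Input aQ [:: i; j] = entryQ P i j by [].
have sA i j : s Input aA [:: i; j] = entryA P i j by [].
have [] := gram_schmidt_run (fun i j => entryQC i j Qpos)
  (fun x => entryQ_gt0 (x := x) Qpos) e0 sQ
  (fun _ => erefl) (fun _ => erefl) (fun _ => erefl).
set s1 := run gram_schmidt e s; set s2 := run image_code e s1.
set s3 := run shift_code e s2; set s4 := run dualQ_code e s3.
set u := fun k j => s1 Pre aU [:: k; j].
move=> cu G; exists u.
have f2P i k : (k < n)%N -> (i < m)%N ->
    s2 Pre aP [:: k; i] = dot n (entryA P i) (u k).
  move=> lk li; rewrite /s2 run_add_nest //.
  rewrite {1}/s1 run_frame // add0r.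
  apply: (nest_sum_pick (N := n) (k0 := k)) => //.
    by move=> k' _ ne; miss.
  apply: (nest_sum_pick (N := m) (k0 := i)) => //.
    by move=> k' _ ne; miss.
  apply: (nest_sum_sum (F := fun j => entryA P i j * u k j)) => // j _.
  by rewrite nest_sum_add // /set_env /= /s1 run_frame.
have f3G : s3 Pre aG = s1 Pre aG by rewrite /s3 /s2 !run_frame.
have f3P : s3 Pre aP = s2 Pre aP by rewrite /s3 run_frame.
have pre4 : prepared u (s4 Pre).
  split=> //.
  - by move=> k j; rewrite /s4 /s3 /s2 !run_frame.
  - by move=> i k li lk; rewrite /s4 run_frame // f3G G.
  - by move=> k i lk li; rewrite /s4 run_frame // f3P f2P.
  - move=> l i ll li; rewrite /s4 run_frame // /s3 run_add_nest //.
    rewrite {1}/s2 run_frame // {1}/s1 run_frame // add0r.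
    apply: (nest_sum_pick (N := n) (k0 := l)) => //.
      by move=> k' _ ne; miss.
    apply: (nest_sum_pick (N := m) (k0 := i)) => //.
      by move=> k' _ ne; miss.
    pose F t := dot n (entryA P i) (u t) *
      dot n (entryQ P l) (u t) / dot n (entryQ P t) (u t).
    rewrite -(sum_shift n l.+1 F).
    apply: (nest_sum_sum (F := fun t => F (l.+1 + t)%N)) => [|t lt].
      by rewrite /= /set_env /= e0 addn1.
    rewrite nest_sum_add // /set_env /= addn1 f2P //; last by lia.
    by rewrite {1 2}/s2 !run_frame // !G //; lia.
  move=> l i j ll li lj; rewrite /s4 run_add_nest //.
  rewrite {1}/s3 run_frame // {1}/s2 run_frame // {1}/s1 run_frame // add0r.
  apply: (nest_sum_pick (N := n) (k0 := l)) => //.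
    by move=> k' _ ne; miss.
  apply: (nest_sum_pick (N := m) (k0 := i)) => //.
    by move=> k' _ ne; miss.
  apply: (nest_sum_pick (N := m) (k0 := j)) => //.
    by move=> k' _ ne; miss.
  pose F t := dot n (entryA P i) (u t) *
      dot n (entryA P j) (u t) / (4 * dot n (entryQ P t) (u t)).
  rewrite -(sum_shift n l F).
  apply: (nest_sum_sum (F := fun t => F (l + t)%N)) => // t lt.
  rewrite nest_sum_add // /set_env /= f3P f3G !f2P //; try lia.
  by rewrite !G //; lia.
split; first by apply: eq_prepared pre4 => a; rewrite run_frame.
rewrite /root_code 5!run_seq.
set t1 := run _ e s4; set t2 := run _ e t1; set t3 := run _ e t2.
set t4 := run _ e t3; set t5 := run _ e t4.
have c0 : node_c P [::] =1 entryc P.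
  by move=> j; rewrite /node_c big_ord0 mulr0 addr0.
have dc0 k : dot n (node_c P [::]) (u k) = dot n (entryc P) (u k).
  by apply: eq_bigr => j _; rewrite c0.
have gam k : (k < n)%N -> t1 Node agam [:: k] = dot n (node_c P [::]) (u k).
  move=> lk; rewrite dc0 /t1 run_add_nest //.
  rewrite {1}/s4 {1}/s3 {1}/s2 {1}/s1 !run_frame // add0r.
  apply: (nest_sum_pick (N := n) (k0 := k)) => //.
    by move=> k' _ ne; miss.
  apply: (nest_sum_sum (F := fun j => entryc P j * u k j)) => // j lj.
  by rewrite nest_sum_add // /set_env /= (prep_U pre4) /s4 /s3 /s2 /s1 !run_frame.
have ac2 j : (j < n)%N -> t2 Node ac [:: j] = entryc P j.
  move=> lj; rewrite /t2 run_add_nest // /t1 /s4 /s3 /s2 /s1 !run_frame // add0r.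
  apply: (nest_sum_pick (N := n) (k0 := j)) => //.
    by move=> k' _ ne; miss.
  by rewrite nest_sum_add // /set_env /= !run_frame.
have ad3 : t3 Node ad [::] = objd P.
  rewrite /t3 run_add_nest // /t2 /t1 /s4 /s3 /s2 /s1 !run_frame // add0r.
  by rewrite nest_sum_add //= !run_frame.
have d0 : node_d P [::] = objd P by rewrite /node_d !big_ord0 !addr0.
have lin5 i : (i < m)%N -> t5 Node out_dualc [:: i] = dual_lin P u [::] i.
  move=> li; rewrite /t5 run_add_nest // {1}/t4 run_add_nest //.
  rewrite {1}/t3 {1}/t2 {1}/t1 {1}/s4 {1}/s3 {1}/s2 {1}/s1 !run_frame // add0r.
  rewrite addrC /dual_lin; congr (_ + _); last first.
    rewrite /node_b big_ord0 subr0.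
    apply: (nest_sum_pick (N := m) (k0 := i)) => //.
      by move=> k' _ ne; miss.
    by rewrite nest_sum_add // /set_env /= /t3 /t2 /t1 /s4 /s3 /s2 /s1 !run_frame.
  apply: (nest_sum_pick (N := m) (k0 := i)) => //.
    by move=> k' _ ne; miss.
  rewrite big_mkord.
  apply: (nest_sum_sum (F := fun t => dot n (entryA P i) (u t) *
    dot n (node_c P [::]) (u t) / (2 * dot n (entryQ P t) (u t)))) => // t lt.
  rewrite nest_sum_add // /set_env /= {2}/t4 /t3 /t2 !run_frame // gam //.
  rewrite /t4 /t3 /t2 /t1 !run_frame //.
  by rewrite (prep_P pre4) // (prep_G pre4).
split.
- by move=> k /andP[_ lk]; rewrite run_frame // /t5 /t4 /t3 /t2 !run_frame // gam.
- move=> j /andP[_ lj]; rewrite run_frame // /t5 /t4 /t3 !run_frame // c0.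
  exact: ac2.
- by rewrite run_frame // /t5 /t4 !run_frame // d0 ad3.
- by move=> i li; rewrite run_frame // lin5.
apply: run_duald => //.
- by apply: eq_prepared pre4 => a; rewrite /t5 /t4 /t3 /t2 /t1 !run_frame.
- by move=> k /andP[_ lk]; rewrite /t5 /t4 /t3 /t2 !run_frame // gam.
- by rewrite /t5 /t4 !run_frame // d0 ad3.
by rewrite /t5 /t4 /t3 /t2 /t1 /s4 /s3 /s2 /s1 !run_frame.
Qed.

(** Each array is updated by the recursion formula of the corresponding
    quantity; the constant is recomputed from the updated products. *)
Lemma run_node_update u pre r v parent :
  posdef (objQ P) -> (size r < n)%N ->
  prepared u pre -> up_to_date u r parent ->
  up_to_date u (rcons r v)
    (run node_code (init_env P (size r).+1) (init_mem P v pre parent) Node).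
Proof.
move=> Qpos lr pre_ok [gam0 ac0 ad0 lin0 cst0].
rewrite /node_code 4!run_seq.
set e := init_env P _; set s := init_mem _ _ _ _.
have e0 : e 0%N = n by [].
have e1 : e 1%N = m by [].
have e3 : e 3%N = (size r).+1 by [].
have pv : s Input aval [::] = v%:~R by [].
have sQ i j : s Input aQ [:: i; j] = entryQ P i j by [].
have sA i j : s Input aA [:: i; j] = entryA P i j by [].
(* all that matters about the initial memory, which is then kept abstract *)
have sN a idx : s Node a idx = 0 by [].
have sPre : s Pre = pre by [].
have sPar : s Parent = parent by [].
clearbody s; set s1 := run _ e s; set s2 := run _ e s1; set s3 := run _ e s2.
set s4 := run _ e s3.
have gam k : (size r < k < n)%N ->
    s1 Node agam [:: k] = dot n (node_c P (rcons r v)) (u k).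
  move=> rk; rewrite /s1 run_add_nest // sN add0r.
  apply: (nest_sum_pick (N := n - (size r).+1) (k0 := k - (size r).+1)) => //.
    by lia.
    by move=> k' _ ne; miss.
  have ek : ((size r).+1 + (k - (size r).+1) = k)%N by lia.
  rewrite nest_sum_add // /set_env /= e3 ek // subn1 /= pv sPar sPre.
  rewrite (prep_G pre_ok) //; try lia.
  by rewrite dot_node_c_rcons gam0 //; lia.
have acs k : (size r < k < n)%N -> s2 Node ac [:: k] = node_c P (rcons r v) k.
  move=> rk; rewrite /s2 run_add_nest // {1}/s1 run_frame // sN add0r.
  apply: (nest_sum_pick (N := n - (size r).+1) (k0 := k - (size r).+1)) => //.
    by lia.
    by move=> k' _ ne; miss.
  have ek : ((size r).+1 + (k - (size r).+1) = k)%N by lia.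
  rewrite nest_sum_add // /set_env /= e3 ek // subn1 /= /s1 !run_frame //.
  rewrite pv sQ sPar.
  by rewrite node_c_rcons ac0 //; lia.
have ads : s3 Node ad [::] = node_d P (rcons r v).
  rewrite /s3 run_add_nest // {1}/s2 {1}/s1 !run_frame // sN add0r.
  rewrite nest_sum_add //=.
  rewrite e3 subn1 /= /s2 /s1 !run_frame // pv sQ sPar.
  by rewrite node_d_rcons // ad0 ac0 // leqnn.
have lin i : (i < m)%N -> s4 Node out_dualc [:: i] = dual_lin P u (rcons r v) i.
  move=> li; rewrite /s4 run_add_nest //.
  rewrite {1}/s3 {1}/s2 {1}/s1 !run_frame // sN add0r.
  apply: (nest_sum_pick (N := m) (k0 := i)) => //.
    by move=> k' _ ne; miss.
  rewrite nest_sum_add // /set_env /= e3 subn1 /= /s3 /s2 /s1 !run_frame //.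
  rewrite pv sA sPar sPre.
  rewrite lin0 // gam0 ?leqnn // (prep_P pre_ok) // (prep_H pre_ok) //.
  by rewrite (prep_G pre_ok) // dual_lin_rcons.
have rng k : (size (rcons r v) <= k < n)%N = (size r < k < n)%N.
  by rewrite size_rcons.
split.
- by move=> k; rewrite rng => rk; rewrite run_frame // /s4 /s3 /s2 !run_frame // gam.
- by move=> k; rewrite rng => rk; rewrite run_frame // /s4 /s3 !run_frame // acs.
- by rewrite run_frame // /s4 run_frame.
- by move=> i li; rewrite run_frame // lin.
apply: run_duald => //.
- by rewrite size_rcons.
- by apply: eq_prepared pre_ok => a; rewrite /s4 /s3 /s2 /s1 !run_frame // sPre.
- by move=> k; rewrite rng => rk; rewrite /s4 /s3 /s2 !run_frame // gam.
- by rewrite /s4 run_frame.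
by rewrite /s4 /s3 /s2 /s1 !run_frame.
Qed.

Lemma stored_up_to_date u r : posdef (objQ P) ->
  prepared u (pre_data pre_code P) ->
  up_to_date u [::] ((run_pre pre_code P).1 Node) ->
  (size r <= n)%N -> up_to_date u r (stored pre_code node_code P r).
Proof.
move=> Qpos pre_ok root; elim/last_ind: r => [//|r v IH].
rewrite size_rcons => lr.
rewrite /stored rev_rcons /= size_rev /run_node exec_run.
by apply: run_node_update => //; apply/IH/ltnW.
Qed.

Lemma pre_loops_below : loops_below (n + m + 1) pre_code (init_env P 0).
Proof.
rewrite /= /set_env /= /init_env /=.
by repeat (split || (let k := fresh "k" in intros k)); lia.
Qed.

Lemma node_loops_below l :
  loops_below (n - l + m) node_code (init_env P l).
Proof.
rewrite /= /set_env /= /init_env /=.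
by repeat (split || (let k := fresh "k" in intros k)); lia.
Qed.

End Correctness.

Theorem corollary3p3 (R : realType) :
  exists pre_prog node_prog : cmd,
    writes_only may_write_pre pre_prog /\
    writes_only may_write_node node_prog /\
    exists a k C : nat,
    forall (n m : nat) (P : miqp R n m),
      posdef (objQ P) -> (n_int P <= n)%N ->
      (pre_time pre_prog P <= a * (n + m + 1) ^ k)%N /\
      (forall r : seq int, (size r < n_int P)%N ->
         available (relaxation_dual (reduced P r)) (size r)
           (pre_data pre_prog P) (stored pre_prog node_prog P r)) /\
      (forall (r : seq int) (v : int), ((size r).+1 < n_int P)%N ->
         (node_time pre_prog node_prog P r v <= C * (n - (size r).+1 + m))%N).
Proof.
exists pre_code, node_code; split=> //; split=> //.
exists (steps pre_code), (nesting pre_code), (steps node_code).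
move=> n m P Qpos le_int.
split; [|split].
- rewrite -[leqRHS]add0n; apply: exec_time; first by rewrite addn1.
  exact: pre_loops_below.
- move=> r lt_r; have ltn : (size r < n)%N by apply: leq_trans le_int.
  have [u [pre_ok root]] := run_preprocessing Qpos.
  have [_ _ _ lin cst] := stored_up_to_date Qpos pre_ok root (ltnW ltn).
  have [dQ dc dd] := relaxation_dualE Qpos (prep_conj pre_ok) (ltnW ltn).
  split=> [i j|i|].
  - by rewrite (prep_dualQ pre_ok) // dQ.
  - by rewrite lin // dc.
  by rewrite cst dd.
move=> r v lt_r.
rewrite -[leqRHS]add0n -[X in (_ + _ * X)%N]expn1.
apply: exec_time; first by rewrite ltn_addr // subn_gt0 (leq_trans lt_r).
exact: node_loops_below.
Qed.
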